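(* For every $\rho^\star>0$ there is a constant $C>0$ depending only on $\rho^\star$ such that, for every positive integer $N$ and all $(i',j')\in\mathscr{F}_N$, $$\lambda_{\min}\big(B_C[i',j']\big)\ge C\big((i')^2+(j')^2\big).$$
   Context: Let $N$ be a positive integer and $\mathscr{F}_N=\{(i',j')\in\mathbb{Z}^2:-N/2\le i',j'<N/2\}$. The imaginary unit is $\mathrm{i}$. Vectors: $\boldsymbol{l}_1=[1/2,-\sqrt3/2]^\top$, $\boldsymbol{l}_2=[1,0]^\top$, $\boldsymbol{l}_3=[1/2,\sqrt3/2]^\top$; $\boldsymbol{l}^\perp$ is $\boldsymbol{l}$ rotated counterclockwise by $\pi/2$; $\boldsymbol{a}\otimes\boldsymbol{b}=\boldsymbol{a}\boldsymbol{b}^\top$ (no conjugation). $\rho^\star>0$ is a fixed parameter. With $k_1=i'$, $k_2=i'+j'$, $k_3=j'$, define $$A_C[i',j']=\sum_{t=1}^3 4(\rho^\star\boldsymbol{l}_t\otimes\boldsymbol{l}_t+12\,\boldsymbol{l}_t^\perp\otimes\boldsymbol{l}_t^\perp)\pi^2k_t^2,\quad \boldsymbol{b}_C[i',j']=\sum_{t=1}^3 24\,\mathrm{i}\,\boldsymbol{l}_t^\perp\pi k_t,\quad c_C[i',j']=36,$$ and the real symmetric $2\times2$ matrix (a Schur complement) $B_C=A_C+\boldsymbol{b}_C\otimes\boldsymbol{b}_C/c_C$. $\lambda_{\min}$ denotes the smallest eigenvalue. *)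

(* Defs.v *)
From mathcomp Require Import all_boot all_order all_algebra.
From mathcomp Require Import complex.
From mathcomp Require Import reals trigo.

Set Implicit Arguments.
Unset Strict Implicit.
Unset Printing Implicit Defensive.

Import Order.TTheory GRing.Theory Num.Theory.

Local Open Scope ring_scope.
Local Open Scope complex_scope.

(* The index t = 1, 2, 3 is represented by 'I_3, that is t = 0, 1, 2. *)

Definition frequencies (N : nat) : pred (int * int) := fun p =>
  (- (N%:Q / 2) <= p.1%:Q < N%:Q / 2) && (- (N%:Q / 2) <= p.2%:Q < N%:Q / 2).

Section Symbols.
Variable R : realType.

Definition vec2 (x y : R) : 'cV[R]_2 := \col_(i < 2) [:: x; y]`_i.

Definition l (t : 'I_3) : 'cV[R]_2 :=
  nth 0 [:: vec2 (1 / 2) (- (Num.sqrt 3 / 2));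
            vec2 1 0;
            vec2 (1 / 2) (Num.sqrt 3 / 2)] t.

Definition perp (v : 'cV[R]_2) : 'cV[R]_2 := vec2 (- v 1 0) (v 0 0).

(* No conjugation, also over the complex numbers. *)
Definition tensor (K : pzRingType) (a b : 'cV[K]_2) : 'M[K]_2 := a *m b^T.

Definition k (p : int * int) (t : 'I_3) : int :=
  [:: p.1; p.1 + p.2; p.2]`_t.

Definition A_C (rho : R) (p : int * int) : 'M[R]_2 :=
  \sum_(t < 3) (4 * pi ^+ 2 * (k p t)%:~R ^+ 2) *:
    (rho *: tensor (l t) (l t) + 12 *: tensor (perp (l t)) (perp (l t))).

Definition b_C (p : int * int) : 'cV[R[i]]_2 :=
  \sum_(t < 3) (24 * 'i * pi%:C * (k p t)%:~R) *:
    map_mx (real_complex R) (perp (l t)).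

Definition c_C : R[i] := 36.

Definition B_C (rho : R) (p : int * int) : 'M[R[i]]_2 :=
  map_mx (real_complex R) (A_C rho p) + c_C^-1 *: tensor (b_C p) (b_C p).

(* In R[i], x <= y means that y - x is real and nonnegative, so the second
   clause also says that every complex eigenvalue of B is real. *)
Definition smallest_eigenvalue (n : nat) (B : 'M[R[i]]_n) (lam : R) : Prop :=
  eigenvalue B lam%:C /\ forall mu : R[i], eigenvalue B mu -> lam%:C <= mu.

End Symbols.

(* Main.v *)
Require Import Defs.
From mathcomp Require Import all_boot all_order all_algebra.
From mathcomp Require Import complex.
From mathcomp Require Import reals.
From mathcomp Require Import trigo ring lra.

(** The quadratic form of B_C splits into two nonnegative pieces.  Since
    b_C is purely imaginary, b_C b_C^T / 36 is the real matrix - 16 pi^2 v v^T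
    with v = k_1 l_1^perp + k_2 l_2^perp + k_3 l_3^perp, so for every real u

      B_C(u) = 4 pi^2 (  rho (sum_t k_t^2 (u . l_t)^2)
                       + 12 (sum_t a_t^2) - 4 (a_1 + a_2 + a_3)^2 ),
      a_t = k_t (u . l_t^perp).

    The last two terms together are nonnegative by Cauchy-Schwarz for three
    numbers, (a_1 + a_2 + a_3)^2 <= 3 (sum_t a_t^2), which is [sqr_sum3_le].
    The first term alone is coercive: at a nonzero frequency at least two of
    the k_t are nonzero, and any two of the l_t span the plane.  Quantitatively
    ([along_coercive]), with k = (x, x + y, y) and Q = x^2 + x y + y^2, the
    matrix sum_t k_t^2 l_t l_t^T equals (Q / 2) Id + w w^T for an explicit
    vector w, so its form is at least (Q / 2) |u|^2, and
    Q / 2 >= (x^2 + y^2) / 4.  This gives the constant C = pi^2 rho.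

    [smallest_eigenvalue_sym2] turns the bound on the form into a bound on the
    smallest eigenvalue in the sense of [smallest_eigenvalue], which quantifies over all
    complex eigenvalues: the characteristic polynomial of a real symmetric
    matrix of size 2 splits over the reals, and a real eigenvector of the
    smaller root compares it with the form. *)

Import Order.TTheory GRing.Theory Num.Theory.

Local Open Scope ring_scope.
Local Open Scope complex_scope.

(** The discriminant of the characteristic polynomial is the sum of squares
    (M 0 0 - M 1 1)^2 + (2 M 0 1)^2, so it has a real square root. *)
Lemma char_poly_sym2_split (R : rcfType) (M : 'M[R]_2) : M^T = M ->
  exists a b : R, a <= b /\ char_poly M = ('X - a%:P) * ('X - b%:P).
Proof.
move=> symM; have M10 : M 1 0 = M 0 1 by rewrite -{1}symM mxE.
pose r := Num.sqrt ((M 0 0 - M 1 1) ^+ 2 + (2 * M 0 1) ^+ 2).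
have r2 : r ^+ 2 = (M 0 0 - M 1 1) ^+ 2 + (2 * M 0 1) ^+ 2.
  by rewrite sqr_sqrtr// addr_ge0// sqr_ge0.
have r0 : 0 <= r by exact: sqrtr_ge0.
exists ((M 0 0 + M 1 1 - r) / 2), ((M 0 0 + M 1 1 + r) / 2); split; first by lra.
set a := _ / 2; set b := _ / 2.
have sum_ab : a + b = M 0 0 + M 1 1 by rewrite /a /b; field.
have prod_ab : a * b = M 0 0 * M 1 1 - M 0 1 ^+ 2.
  by rewrite /a /b; nra.
have -> : char_poly M = 'X ^+ 2 - (M 0 0 + M 1 1)%:P * 'X
                        + (M 0 0 * M 1 1 - M 0 1 ^+ 2)%:P.
  rewrite /char_poly (expand_det_row _ 0) !big_ord_recl big_ord0 /cofactor.
  rewrite !det_mx11 !mxE /=.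
  have -> : lift (lift ord0 ord0) 0 = 0 :> 'I_2 by exact: val_inj.
  have -> : lift 0 0 = 1 :> 'I_2 by exact: val_inj.
  rewrite M10 !polyCD polyCN polyCM expr2 polyCM.
  ring.
rewrite -sum_ab -prod_ab (polyCD a b) (polyCM a b); ring.
Qed.

(** Both complex eigenvalues are the real roots of the characteristic
    polynomial, so the smaller root is the value of the form at a real
    eigenvector divided by its squared norm. *)
Lemma smallest_eigenvalue_sym2 (R : realType) (M : 'M[R]_2) (m : R) :
  M^T = M ->
  (forall u : 'rV[R]_2, m * (u *m u^T) 0 0 <= (u *m M *m u^T) 0 0) ->
  exists2 lam : R, smallest_eigenvalue (map_mx (real_complex R) M) lam &
    m <= lam.
Proof.
move=> symM le_m; have [a [b [le_ab chiM]]] := char_poly_sym2_split _ M symM.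
have eig_a : eigenvalue M a.
  by rewrite eigenvalue_root_char chiM rootM root_XsubC eqxx.
exists a; first split.
- by rewrite (eigenvalue_map (real_complex R)).
- move=> mu; rewrite eigenvalue_root_char -map_char_poly chiM rmorphM /=.
  rewrite !map_polyXsubC rootM !root_XsubC => /orP[]/eqP->.
    by [].
  by rewrite lecR.
- have /eigenvalueP[u uM u_neq0] := eig_a.
  have u2 : (u *m u^T) 0 0 = u 0 0 ^+ 2 + u 0 1 ^+ 2.
    rewrite mxE big_ord_recl big_ord1 !mxE -!expr2.
    by congr (_ + u _ _ ^+ 2); apply: val_inj.
  have u2_gt0 : 0 < (u *m u^T) 0 0.
    rewrite lt0r u2 addr_ge0 ?sqr_ge0// andbT paddr_eq0 ?sqr_ge0//.
    rewrite !sqrf_eq0; apply: contra u_neq0 => /andP[/eqP u0 /eqP u1].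
    apply/eqP/rowP => i; rewrite !mxE.
    by case: i => [[|[|//]] lti]; [rewrite -u0|rewrite -u1];
      congr (u _ _); apply: val_inj.
  by have := le_m u; rewrite uM -scalemxAl [X in _ <= X]mxE ler_pM2r.
Qed.

Section Form.
Variables (R : realType) (rho : R) (p : int * int).

Definition sum_perp : 'cV[R]_2 := \sum_(t < 3) (k p t)%:~R *: perp (l R t).

Definition B_C_real : 'M[R]_2 :=
  A_C rho p - (16 * pi ^+ 2) *: tensor sum_perp sum_perp.

Lemma b_CE : b_C R p =
  (24 * 'i * (pi : R)%:C) *: map_mx (real_complex R) sum_perp.
Proof.
rewrite /b_C /sum_perp raddf_sum scaler_sumr; apply: eq_bigr => t _ /=.
by rewrite map_mxZ scalerA rmorph_int.
Qed.

Lemma B_CE : B_C rho p = map_mx (real_complex R) B_C_real.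
Proof.
rewrite /B_C /B_C_real map_mxD map_mxN map_mxZ b_CE; congr (_ + _).
rewrite /tensor linearZ /= -scalemxAl -scalemxAr !scalerA map_mxM map_trmx.
rewrite -scaleNr; congr (_ *: _).
rewrite rmorphM rmorphXn rmorph_nat /c_C.
have -> : 36^-1 * (24 * 'i * pi%:C) * (24 * 'i * pi%:C) =
  36^-1 * 24 * 24 * 'i ^+ 2 * pi%:C ^+ 2 :> R[i] by ring.
by rewrite sqr_i; field.
Qed.

Lemma tr_tensor (u v : 'cV[R]_2) : (tensor u v)^T = tensor v u.
Proof. by rewrite /tensor trmx_mul trmxK. Qed.

Lemma B_C_real_sym : B_C_real^T = B_C_real.
Proof.
rewrite /B_C_real linearB linearZ /= tr_tensor; congr (_ - _).
rewrite /A_C raddf_sum; apply: eq_bigr => t _ /=.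
by rewrite linearZ linearD !linearZ /= !tr_tensor.
Qed.

Lemma form_tensor (u : 'rV[R]_2) (v : 'cV[R]_2) :
  (u *m tensor v v *m u^T) 0 0 = (u *m v) 0 0 ^+ 2.
Proof.
rewrite /tensor mulmxA -mulmxA mxE big_ord1 expr2; congr (_ * _).
by rewrite -trmx_mul mxE.
Qed.

Lemma form_B_C_real (u : 'rV[R]_2) :
  let along t := (k p t)%:~R * (u *m l R t) 0 0 in
  let across t := (k p t)%:~R * (u *m perp (l R t)) 0 0 in
  (u *m B_C_real *m u^T) 0 0 =
  4 * pi ^+ 2 * (rho * \sum_(t < 3) along t ^+ 2
                 + (12 * \sum_(t < 3) across t ^+ 2
                    - 4 * (\sum_(t < 3) across t) ^+ 2)).
Proof.
move=> along across.
have form_sum : (u *m sum_perp) 0 0 = \sum_(t < 3) across t.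
  rewrite /sum_perp mulmx_sumr summxE; apply: eq_bigr => t _.
  by rewrite -scalemxAr mxE.
rewrite /B_C_real mulmxBr mulmxBl mxE [X in _ + X]mxE.
rewrite -scalemxAr -scalemxAl [X in _ - X]mxE form_tensor form_sum.
have -> : (u *m A_C rho p *m u^T) 0 0 =
  4 * pi ^+ 2 * (rho * \sum_(t < 3) along t ^+ 2
                 + 12 * \sum_(t < 3) across t ^+ 2).
  rewrite /A_C mulmx_sumr mulmx_suml summxE !mulr_sumr -big_split mulr_sumr.
  apply: eq_bigr => t _ /=.
  rewrite -scalemxAr -scalemxAl mxE mulmxDr mulmxDl [X in _ * X]mxE.
  rewrite -!scalemxAr -!scalemxAl [X in X + _]mxE [X in _ + X]mxE.
  rewrite !form_tensor /along /across.
  by ring.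
by ring.
Qed.

(** In terms of k = (x, x + y, y), the difference of the two sides is
    |u|^2 (x + y)^2 / 4 + (u . w)^2, where
    w = (sqrt 3 (x + y) / 2, (y - x) / 2). *)
Lemma along_coercive (u : 'rV[R]_2) :
  (p.1%:~R ^+ 2 + p.2%:~R ^+ 2) / 4 * (u *m u^T) 0 0 <=
  \sum_(t < 3) ((k p t)%:~R * (u *m l R t) 0 0) ^+ 2.
Proof.
rewrite !big_ord_recl big_ord0 addr0 !mxE !big_ord_recl !big_ord0 /= !mxE /=.
have k0 : k p ord0 = p.1 by [].
have k1 : k p (lift ord0 ord0) = p.1 + p.2 by [].
have k2 : k p (lift ord0 (lift ord0 ord0)) = p.2 by [].
rewrite {}k0 {}k1 {}k2 rmorphD /=.
move: (p.1%:~R) (p.2%:~R) (u 0 ord0) (u 0 (lift ord0 ord0)) => x y u0 u1.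
have s2 : Num.sqrt 3 ^+ 2 = 3 :> R by rewrite sqr_sqrtr.
move: (Num.sqrt 3) s2 => s s2.
rewrite -subr_ge0; set d := (X in 0 <= X).
have -> : d = (u0 ^+ 2 + u1 ^+ 2) * ((x + y) / 2) ^+ 2
              + (s * (x + y) / 2 * u0 + (y - x) / 2 * u1) ^+ 2.
  (* The coefficients of u0 ^+ 2 and u1 ^+ 2 differ by multiples of s ^+ 2 - 3. *)
  apply/eqP; rewrite -subr_eq0; apply/eqP.
  transitivity ((s ^+ 2 - 3) *
    ((x ^+ 2 + y ^+ 2) * u1 ^+ 2 - (x + y) ^+ 2 * u0 ^+ 2) / 4).
    by rewrite /d; field.
  by rewrite s2 subrr !mul0r.
by rewrite addr_ge0 ?sqr_ge0// mulr_ge0 ?sqr_ge0// addr_ge0 ?sqr_ge0.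
Qed.

End Form.

(** Cauchy-Schwarz against (1, 1, 1): the difference of the two sides is the
    sum of the squares of the pairwise differences. *)
Lemma sqr_sum3_le (R : realDomainType) (a : 'I_3 -> R) :
  (\sum_(t < 3) a t) ^+ 2 <= 3 * \sum_(t < 3) a t ^+ 2.
Proof.
rewrite !big_ord_recl !big_ord0.
move: (a _) (a _) (a _) => a0 a1 a2; rewrite -subr_ge0.
set d := (X in 0 <= X).
have -> : d = (a0 - a1) ^+ 2 + (a1 - a2) ^+ 2 + (a0 - a2) ^+ 2.
  by rewrite /d; ring.
by rewrite !addr_ge0 ?sqr_ge0.
Qed.

Theorem proposition4p5 (R : realType) (rho : R) (hrho : 0 < rho) :
  exists2 C : R, 0 < C &
    forall (N : nat) (p : int * int), (0 < N)%N -> frequencies N p ->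
      exists2 lam : R, smallest_eigenvalue (B_C rho p) lam &
        C * (p.1%:~R ^+ 2 + p.2%:~R ^+ 2) <= lam.
Proof.
have pi2_gt0 : 0 < (pi : R) ^+ 2 by rewrite exprn_gt0 ?pi_gt0.
exists (pi ^+ 2 * rho) => [|N p _ _]; first by rewrite mulr_gt0.
rewrite B_CE; apply: smallest_eigenvalue_sym2 => [|u].
  exact: B_C_real_sym.
rewrite form_B_C_real.
have along_ge := along_coercive _ p u.
have across_ge := sqr_sum3_le _
  (fun t => (k p t)%:~R * (u *m perp (l R t)) 0 0).
set S := p.1%:~R ^+ 2 + p.2%:~R ^+ 2 in along_ge *.
rewrite [leLHS](_ : _ = 4 * pi ^+ 2 * (rho * (S / 4 * (u *m u^T) 0 0)));
  last by field.
rewrite ler_pM2l; last by rewrite mulr_gt0.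
rewrite -[leLHS]addr0 lerD ?ler_pM2l//.
by rewrite subr_ge0; lra.
Qed.
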